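(* For every $n\ge 1$, the total number of strict left to right maxima, summed over all Dyck paths of semi-length $n$, equals \[ \sum_{r=1}^n \bigl(d(r+1)-d(r)\bigr)\left(\binom{2n-1}{n-r}-\binom{2n-1}{n-r-1}\right), \] where $d(m)$ is the number of positive divisors of $m$ (and $\binom{2n-1}{-1}=0$).
   Context: A Dyck path of semi-length $n$ is a lattice path from $(0,0)$ to $(2n,0)$ with $n$ up steps $(1,1)$ and $n$ down steps $(1,-1)$ never going below the $x$-axis. A peak is an up step immediately followed by a down step, and its height is the height of its top point. A strict left to right maximum is a peak whose height is strictly greater than the heights of all peaks to its left. *)

(* Defs.v *)
From HB Require Import structures.
From mathcomp Require Import all_boot all_order all_algebra.
Set Implicit Arguments.
Unset Strict Implicit.
Unset Printing Implicit Defensive.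
Import Order.TTheory GRing.Theory Num.Theory.
Local Open Scope ring_scope.

(* Lattice paths from (0,0) are step words: [true] is the up step (1,1) and
   [false] the down step (1,-1).  [height s k] is the ordinate of the vertex
   with abscissa [k <= size s]. *)
Definition height (s : seq bool) (k : nat) : int :=
  (count id (take k s))%:Z - (count negb (take k s))%:Z.

Definition dyck (n : nat) (s : seq bool) : bool :=
  [&& count id s == n, count negb s == n
    & all (fun k => 0 <= height s k) (iota 0 (size s).+1)].

(* Steps are indexed from 0: a peak [i] consists of the steps [i] and [i.+1],
   and its top point has abscissa [i.+1]. *)
Definition peak (s : seq bool) (i : nat) : bool :=
  [&& (i.+1 < size s)%N, nth true s i & ~~ nth true s i.+1].

Definition peak_height (s : seq bool) (i : nat) : int := height s i.+1.

Definition strict_ltr_max (s : seq bool) (i : nat) : bool :=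
  peak s i &&
  all (fun j => peak s j ==> (peak_height s j < peak_height s i)) (iota 0 i).

Definition num_strict_ltr_max (s : seq bool) : nat :=
  count (strict_ltr_max s) (iota 0 (size s)).

Definition num_divisors (m : nat) : nat := size (divisors m).

(* The lower index is an integer, so that the coefficient vanishes when it is
   negative; subtraction on [nat] would truncate -1 to 0. *)
Definition binz (m : nat) (k : int) : int :=
  match k with
  | Posz k' => 'C(m, k')%:Z
  | Negz _ => 0
  end.

(* Main.v *)
(** A strict left to right maximum of height [h] is a first passage to height
    [h] that is followed by a down step, so the total is a sum over [h >= 1] of
    numbers of such paths.  Reflecting repeatedly in the levels [-1] and [h]
    counts the paths for a given [h] as
    [\sum_(j >= 1) (g ((h + 1) j - 1) - g ((h + 1) j))],
    where [g r] is the number of paths of length [2 n] that first reach 0 from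
    height [2 r] at their last step.  Collecting the terms with [(h + 1) j = q]
    gives [(d q - 1) (g (q - 1) - g q)], because [h + 1 = 1] is excluded, and
    summation by parts leaves [\sum_r (d (r + 1) - d r) g r]; the ballot theorem
    evaluates [g r]. *)

Require Import Defs.
From mathcomp Require Import all_boot all_order all_algebra.
From mathcomp Require Import zify ring.
Import GRing.Theory.
Local Open Scope ring_scope.

(* The path starting at height [k] stays nonnegative and ends at height 0. *)
Fixpoint valid (k : nat) (s : seq bool) : bool :=
  match s, k with
  | [::], _ => k == 0%N
  | true :: s', _ => valid k.+1 s'
  | false :: s', 0 => false
  | false :: s', k'.+1 => valid k' s'
  end.

(* The first visit to level [d] above the start is followed by a down step. *)
Fixpoint hit (d : nat) (s : seq bool) : bool :=
  match s, d with
  | [::], _ => false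
  | b :: s', 0 => ~~ b
  | true :: s', d'.+1 => hit d' s'
  | false :: s', d'.+1 => hit d.+1 s'
  end.

(* The number of paths of length [m] from height [a] whose first visit to height
   0 is at their end. *)
Fixpoint fpass (m a : nat) : int :=
  match m, a with
  | 0, _ => (a == 0%N)%:R
  | m'.+1, 0 => 0
  | m'.+1, a'.+1 => fpass m' a'.+2 + fpass m' a'
  end.

(** * Heights and peaks under removal of the first step *)

Lemma all_iotaS (P : pred nat) n :
  all P (iota 0 n.+1) = P 0%N && all (fun i => P i.+1) (iota 0 n).
Proof. by rewrite /= (iotaDl 1 0) all_map. Qed.

Lemma count_iotaS (P : pred nat) n :
  count P (iota 0 n.+1) = (P 0 + count (fun i => P i.+1) (iota 0 n))%N.
Proof. by rewrite /= (iotaDl 1 0) count_map. Qed.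

Lemma height_cons b s i :
  height (b :: s) i.+1 = (if b then 1 else -1) + height s i.
Proof. by rewrite /height /=; case: b => /=; lia. Qed.

Lemma peak_cons b s i : peak (b :: s) i.+1 = peak s i.
Proof. by []. Qed.

Lemma validE k s :
  valid k s = all (fun i => 0 <= k%:Z + height s i) (iota 0 (size s).+1)
              && (k%:Z + height s (size s) == 0).
Proof.
elim: s k => [|b s IH] k; first by rewrite /= /height /=; lia.
rewrite [size _]/= all_iotaS height_cons.
have -> : 0 <= k%:Z + height (b :: s) 0 by rewrite /height /=; lia.
case: b.
  rewrite [LHS]IH; congr (_ && _); last by congr (_ == _); lia.
  by apply: eq_all => i /=; rewrite height_cons; congr (_ <= _); lia.
case: k => [|k].
  by rewrite all_iotaS height_cons /height take0.
rewrite [LHS]IH; congr (_ && _); last by congr (_ == _); lia.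
by apply: eq_all => i /=; rewrite height_cons; congr (_ <= _); lia.
Qed.

Lemma dyckE n s : size s = (2 * n)%N -> dyck n s = valid 0 s.
Proof.
move=> sz; rewrite validE /dyck.
have E : height s (size s) = (count id s)%:Z - (count negb s)%:Z.
  by rewrite /height take_size.
have C : (count id s + count negb s = 2 * n)%N by rewrite -sz -(count_predC id s).
rewrite E andbA andbC; congr (_ && _); last by lia.
by apply: eq_all => i; rewrite add0r.
Qed.

(** The initial run of up steps ends in such a [j], the first peak of the word. *)
Lemma positive_peak_before s i : peak (true :: s) i ->
  exists2 j, (j <= i)%N & peak (true :: s) j && (0 < peak_height (true :: s) j).
Proof.
elim: s i => [|b s IH] i; first by rewrite /peak; case: i.
case: b IH => IH.
  case: i => [//|i]; rewrite peak_cons => /IH [j ji /andP [pj hj]].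
  exists j.+1 => //; rewrite peak_cons pj /=.
  by move: hj; rewrite /peak_height (height_cons true (true :: s)); lia.
by move=> _; exists 0%N.
Qed.

Lemma strict_ltr_max_gt0 s i :
  strict_ltr_max (true :: s) i -> 0 < peak_height (true :: s) i.
Proof.
case/andP=> /positive_peak_before [j ji /andP [pj hj]] /allP H.
move: ji; rewrite leq_eqVlt => /orP [/eqP <- //|ji].
have := H j; rewrite mem_iota ji pj => /(_ isT) /=; lia.
Qed.

Lemma strict_ltr_max_cons b s i :
  strict_ltr_max (b :: s) i.+1 = strict_ltr_max s i &&
    (peak (b :: s) 0 ==> (peak_height (b :: s) 0 < peak_height (b :: s) i.+1)).
Proof.
rewrite /strict_ltr_max peak_cons -andbA; congr (_ && _).
rewrite all_iotaS andbC.
congr (_ && _); apply: eq_all => j /=.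
by rewrite peak_cons /peak_height !height_cons; case: b => /=; lia.
Qed.

(** A path that has already visited a positive height and climbs to it again has turned down in
    between, at a peak at least as high. So a strict maximum is a first visit, and each height has
    at most one. *)
Lemma count_strict_ltr_max_height s d :
  count (fun i => strict_ltr_max s i && (peak_height s i == d.+1%:Z))
    (iota 0 (size s)) = hit d.+1 s.
Proof.
elim: s d => [//|b s IH] d.
rewrite [size _]/= count_iotaS.
case: b.
  have p0 : peak_height (true :: s) 0 = 1 by rewrite /peak_height height_cons /height take0.
  have m0 : strict_ltr_max (true :: s) 0 = hit 0 s.
    by rewrite /strict_ltr_max /= andbT /peak /=; case: s {IH p0} => [|[]].
  rewrite p0 m0; case: d => [|d].
    (* After a second up step, later strict maxima exceed height 1; after a down step, the peak just
       passed rules out another of height 1. *)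
    rewrite andbT (_ : count _ _ = 0%N) ?addn0 //.
    apply/eqP; rewrite -leqn0 leqNgt -has_count; apply/hasPn => i _.
    rewrite /= strict_ltr_max_cons p0.
    case: s {IH} m0 p0 => [|[] s] m0 p0 //=.
    - by apply/negP => /andP [/andP [/strict_ltr_max_gt0 h _] /eqP];
        move: h; rewrite /peak_height !(height_cons true) /=; lia.
    - by rewrite -andbA; apply/negP => /andP [_ /andP [/= h /eqP e]]; move: h; rewrite e.
  rewrite andbF add0n -IH; apply: eq_count => i /=.
  rewrite strict_ltr_max_cons p0 /peak_height height_cons /=.
  by case: (strict_ltr_max s i) => //=; case: (peak _ _) => /=; lia.
have p0 : peak (false :: s) 0 = false by rewrite /peak andbF.
rewrite {1}/strict_ltr_max p0 add0n -[RHS]/(nat_of_bool (hit d.+2 s)) -IH.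
apply: eq_count => i /=.
rewrite strict_ltr_max_cons p0 andbT /peak_height height_cons.
by congr (_ && _); lia.
Qed.

Lemma num_strict_ltr_maxE s N : valid 0 s -> (size s <= N)%N ->
  num_strict_ltr_max s = (\sum_(0 <= d < N) hit d.+1 s)%N.
Proof.
rewrite validE => /andP [/allP pos _] sz.
under eq_bigr do rewrite -count_strict_ltr_max_height -sum1_count big_mkcond.
rewrite exchange_big /= /num_strict_ltr_max -sum1_count big_mkcond /=.
apply: eq_big_seq => i; rewrite mem_iota add0n => /andP [_ isz].
case: ifP => [mi|]; last by rewrite big1.
have hi : 0 <= height s i.
  by have := pos i; rewrite mem_iota add0n ltnS (ltnW isz) add0r; apply.
have si : nth true s i by case/andP: mi => /and3P [].
have hi1 : height s i.+1 = height s i + 1.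
  by rewrite /height (take_nth true) // si -cats1 !count_cat /=; lia.
have hi2 : height s i <= i%:Z.
  have := count_size id (take i s); rewrite size_take isz /height; lia.
rewrite /peak_height hi1.
have [d hd] : exists d : nat, height s i = d%:Z by exists `|height s i|%N; lia.
rewrite hd in hi hi2 *.
rewrite (bigD1_seq d) /= ?mem_index_iota ?iota_uniq //; last by lia.
rewrite (_ : _ + 1 == _) ?big1 //; last by lia.
by move=> e ed; rewrite (_ : _ == _ = false) //; lia.
Qed.

(** * Counting by reflection and ballot numbers *)

Lemma sum_tuple_cons (V : nmodType) m (F : seq bool -> V) :
  \sum_(t : m.+1.-tuple bool) F t =
  \sum_(t : m.-tuple bool) F (true :: t) + \sum_(t : m.-tuple bool) F (false :: t).
Proof.
pose c (p : bool * m.-tuple bool) := cons_tuple p.1 p.2.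
rewrite (reindex c) /=; last first.
  exists (fun t => (thead t, behead_tuple t)).
    by move=> [b t] _ /=; congr pair; apply: val_inj.
  by move=> t _; case/tupleP: t => b t; apply: val_inj.
rewrite -(big_bool _ (fun b => \sum_(t : m.-tuple bool) F (b :: t))).
by rewrite (pair_bigA _ (fun b (t : m.-tuple bool) => F (b :: t))).
Qed.

Lemma fpassSS m a : fpass m.+1 a.+1 = fpass m a.+2 + fpass m a.
Proof. by []. Qed.

Lemma fpass_gt m a : (m < a)%N -> fpass m a = 0.
Proof.
elim: m a => [|m IH] [|a] //= h.
by rewrite !IH ?addr0 //; lia.
Qed.

Lemma sum_tuple0 (V : nmodType) (F : seq bool -> V) :
  \sum_(t : 0.-tuple bool) F t = F [::].
Proof.
rewrite (big_pred1 [tuple]) // => t; apply/esym/eqP; exact: tuple0.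
Qed.

(* A final down step to -1 turns a path ending at 0 into a first passage. *)
Lemma sum_valid m k :
  \sum_(t : m.-tuple bool) (valid k t)%:R = fpass m.+1 k.+1.
Proof.
elim: m k => [|m IH] k.
  by rewrite (sum_tuple0 _ (fun s => (valid k s)%:R)) /= add0r.
rewrite (sum_tuple_cons _ _ (fun s => (valid k s)%:R)) /= IH.
case: k => [|k]; first by rewrite big1_eq.
by rewrite IH.
Qed.

(* The two families are the images of the start under the reflections in -1 and
   [k + d]: the sum satisfies the same recurrence in [k], the families cancel at
   [k = -1], and they telescope at [d = 0].  Truncating at [J >= m] is harmless
   because [fpass m] vanishes beyond [m]. *)
Lemma sum_valid_hit J m k d : (m <= J)%N -> (0 < k + d)%N ->
  \sum_(t : m.-tuple bool) (valid k t && hit d t)%:R =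
  \sum_(j < J) (fpass m (k + 2 * d + j * (2 * (k + d) + 2))
              - fpass m (3 * k + 2 * d + 2 + j * (2 * (k + d) + 2))).
Proof.
elim: m k d => [|m IH] k d mJ kd.
  rewrite (sum_tuple0 _ (fun s => (valid k s && hit d s)%:R)) /= andbF.
  by rewrite big1 // => j _; rewrite (_ : _ == _ = false) 1?(_ : _ == _ = false) //=; lia.
rewrite (sum_tuple_cons _ _ (fun s => (valid k s && hit d s)%:R)).
case: d kd => [|d] kd.
  case: k kd => [|k] kd; first by lia.
  rewrite [X in X + _]big1 => [|t _]; last by rewrite /= andbF.
  rewrite add0r (eq_bigr (fun t : m.-tuple bool => (valid k t)%:R)) => [|t _]; last first.
    by rewrite /= andbT.
  rewrite sum_valid.
  pose f j := - fpass m.+1 (k.+1 + j * (2 * k.+1 + 2)).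
  rewrite (eq_bigr (fun j : 'I_J => f j.+1 - f j)) => [|j _]; last first.
    rewrite /f opprK [RHS]addrC; congr (fpass m.+1 _ - fpass m.+1 _); lia.
  rewrite -(big_mkord xpredT (fun j => f j.+1 - f j)) telescope_sumr // /f.
  by rewrite [fpass _ (_ + J * _)]fpass_gt ?oppr0 ?opprK ?add0r ?mul0n ?addn0 //; nia.
case: k kd => [|k] kd.
  rewrite [X in _ + X]big1 // addr0 [LHS]/= IH; [|lia..].
  apply: eq_bigr => j _.
  set p := (j * _)%N.
  have -> : (0 + 2 * d.+1 + p = (2 * d + p + 1).+1)%N by lia.
  have -> : (3 * 0 + 2 * d.+1 + 2 + p = (2 * d + p + 3).+1)%N by lia.
  rewrite !fpassSS.
  have -> : (1 + 2 * d + p = 2 * d + p + 1)%N by lia.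
  have -> : (3 * 1 + 2 * d + 2 + p = (2 * d + p + 3).+2)%N by lia.
  have -> : ((2 * d + p + 1).+2 = 2 * d + p + 3)%N by lia.
  ring.
rewrite [LHS]/= !IH; [|lia..].
rewrite -big_split; apply: eq_bigr => j _; rewrite [LHS]/=.
(* A step preserves [k + d], so the three periods agree. *)
set p := (j * _)%N; set q := (j * _)%N; set r := (j * _)%N.
have -> : q = p by rewrite /p /q; nia.
have -> : r = p by rewrite /p /r; nia.
have -> : (k.+1 + 2 * d.+1 + p = (k + 2 * d + p + 2).+1)%N by lia.
have -> : (3 * k.+1 + 2 * d.+1 + 2 + p = (3 * k + 2 * d + 6 + p).+1)%N by lia.
rewrite !fpassSS.
have -> : (k.+2 + 2 * d + p = k + 2 * d + p + 2)%N by lia.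
have -> : (k + 2 * d.+2 + p = (k + 2 * d + p + 2).+2)%N by lia.
have -> : (3 * k.+2 + 2 * d + 2 + p = (3 * k + 2 * d + 6 + p).+2)%N by lia.
have -> : (3 * k + 2 * d.+2 + 2 + p = 3 * k + 2 * d + 6 + p)%N by lia.
ring.
Qed.

(** Here [b] counts the up steps. Pascal's rule gives the right-hand side the recurrence of [fpass],
    and symmetry of the binomials makes it vanish at [a = 0]. *)
Lemma fpassE m a b : (a + 2 * b = m.+1)%N ->
  fpass m.+1 a = binz m b%:Z - binz m (b%:Z - 1).
Proof.
have binzS i j : binz i.+1 j%:Z = binz i j%:Z + binz i (j%:Z - 1).
  case: j => [|j]; first by rewrite /= !bin0.
  by rewrite (_ : j.+1%:Z - 1 = j%:Z) /= ?binS //; lia.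
elim: m a b => [|m IH] a b h.
  have [-> ->] : a = 1%N /\ b = 0%N by lia.
  by [].
case: a h => [|a] h.
  rewrite [LHS]/= (_ : b%:Z - 1 = b.-1%:Z) /=; last by lia.
  by rewrite -bin_sub ?subrr; [|lia]; rewrite (_ : m.+1 - b = b.-1)%N ?subrr //; lia.
rewrite fpassSS.
rewrite (IH a b); last by lia.
case: b h => [|b] h.
  by rewrite fpass_gt /= ?bin0 //; lia.
rewrite (IH a.+2 b); last by lia.
have -> : b.+1%:Z - 1 = b%:Z by lia.
by rewrite !binzS (_ : b.+1%:Z - 1 = b%:Z) //; [ring|lia].
Qed.

(** * Divisor sums and summation by parts *)

Lemma num_divisorsE q N : (0 < q < N)%N ->
  num_divisors q = (\sum_(1 <= m < N) (m %| q))%N.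
Proof.
case/andP=> q0 qN.
rewrite (eq_bigr (fun m => if (m %| q)%N then 1%N else 0%N)) => [|m _]; last by case: dvdn.
rewrite -big_mkcond sum1_count -size_filter; apply/perm_size/uniq_perm.
- exact: divisors_uniq.
- by rewrite filter_uniq // iota_uniq.
move=> m; rewrite mem_filter mem_index_iota -dvdn_divisors //.
case mq : (m %| q)%N => //=.
by rewrite (dvdn_gt0 q0 mq) (leq_ltn_trans (dvdn_leq q0 mq)).
Qed.

Lemma sum_multiples (V : nmodType) (F : nat -> V) m N J :
  (0 < m)%N -> (N <= J.+1)%N -> (forall q, (N <= q)%N -> F q = 0) ->
  \sum_(j < J) F (m * j.+1)%N = \sum_(1 <= q < N) F q *+ (m %| q).
Proof.
move=> m0 NJ F0.
transitivity (\sum_(j < J) \sum_(1 <= q < N) F q *+ (q == m * j.+1)%N).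
  apply: eq_bigr => j _; have [Nq|qN] := leqP N (m * j.+1).
    rewrite F0 // big_nat big1 // => q /andP [_ qN].
    by rewrite (_ : _ == _ = false) //; lia.
  rewrite (bigD1_seq (m * j.+1)%N) ?mem_index_iota ?iota_uniq //=; last by nia.
  by rewrite eqxx big1 ?addr0 // => q /negbTE ->.
rewrite exchange_big; apply: eq_big_nat => q /andP [q0 qN] /=.
have [/dvdnP [c qE]|ndvd] := boolP (m %| q)%N; last first.
  rewrite big1 // => j _; rewrite (_ : _ == _ = false) //.
  by apply/negbTE; apply: contra ndvd => /eqP ->; rewrite dvdn_mulr.
have cJ : (c.-1 < J)%N by nia.
have cS : c.-1.+1 = c by nia.
rewrite (bigD1 (Ordinal cJ)) //= cS qE mulnC eqxx big1 ?addr0 // => j jc.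
rewrite (_ : _ == _ = false) //; apply/negbTE; apply: contra jc => /eqP e.
by apply/eqP/val_inj => /=; nia.
Qed.

Lemma sum_by_parts (R : comPzRingType) (g E : nat -> R) n :
  \sum_(1 <= q < n.+2) (g q.-1 - g q) * E q =
  g 0 * E 1 - g n.+1 * E n.+1 + \sum_(1 <= r < n.+1) (E r.+1 - E r) * g r.
Proof.
elim: n => [|n IH]; first by rewrite big_nat1 big_geq // addr0 mulrBl.
rewrite big_nat_recr // IH [in RHS]big_nat_recr //=; ring.
Qed.

Theorem theorem4 (n : nat) (hn : (1 <= n)%N) :
  (\sum_(p : (2 * n).-tuple bool | dyck n p) num_strict_ltr_max p)%N%:Z =
  \sum_(1 <= r < n.+1)
    ((num_divisors r.+1)%:Z - (num_divisors r)%:Z) *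
    (binz (2 * n - 1) (n%:Z - r%:Z) - binz (2 * n - 1) (n%:Z - r%:Z - 1)).
Proof.
pose g r := fpass (2 * n) (2 * r).
pose F q := g q.-1 - g q.
have F0 q : (n.+2 <= q)%N -> F q = 0.
  by move=> h; rewrite /F /g !fpass_gt ?subrr //; lia.
transitivity (\sum_(d < 2 * n) \sum_(p : (2 * n).-tuple bool)
                (valid 0 p && hit d.+1 p)%:R : int).
  rewrite exchange_big -natz natr_sum big_mkcond; apply: eq_bigr => p _ /=.
  rewrite dyckE ?size_tuple //; case: ifP => [v|_]; last by rewrite big1.
  by rewrite (@num_strict_ltr_maxE _ (2 * n)) ?size_tuple // big_mkord natr_sum.
transitivity (\sum_(d < 2 * n) \sum_(1 <= q < n.+2) F q *+ (d.+2 %| q)).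
  apply: eq_bigr => d _.
  rewrite -(@sum_multiples _ F _ _ (2 * n)) //; last by lia.
  rewrite (@sum_valid_hit (2 * n)) //; apply: eq_bigr => j _.
  (* At [k = 0] the two families start at heights [2 * (q - 1)] and [2 * q] with
     [q = d.+2 * j.+1]. *)
  by rewrite /F /g; congr (fpass _ _ - fpass _ _); nia.
rewrite exchange_big /=.
transitivity (\sum_(1 <= q < n.+2) F q * ((num_divisors q)%:Z - 1)).
  apply: eq_big_nat => q /andP [q0 qn].
  (* The values [d.+2] run from 2 to [2 * n + 1], which covers every divisor of [q <= n.+1] except
     1. *)
  rewrite sumrMnr -mulr_natr (@num_divisorsE _ (2 * n).+2); last by lia.
  by rewrite big_nat_recl // dvd1n big_add1 big_mkord PoszD addrC addKr natz.
(* Both boundary terms vanish: 1 has a single divisor, and [2 * n] steps cannot descend from height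
   [2 * n.+1] to 0. *)
rewrite sum_by_parts; set D1 := num_divisors 1; have -> : D1 = 1%N by [].
rewrite subrr mulr0 add0r /g [fpass _ (2 * n.+1)]fpass_gt; last by lia.
rewrite mul0r oppr0 add0r; apply: eq_big_nat => r /andP [r0 rn].
have [m mE] : exists m, (2 * n = m.+1)%N by exists (2 * n).-1; lia.
rewrite mE (@fpassE _ _ (n - r)); last by lia.
rewrite subn1 -subzn; last by lia.
by congr (_ * _); lia.
Qed.
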